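(* The topological space $(\mathcal V,\mathcal T_d)$, where $\mathcal V=\bigcup_{n\ge 1}\mathbb R^n$ and $\mathcal T_d$ is the topology induced by the (pseudo-)distance $d_{\mathcal V}$, is path-wise connected.
   Context: $\mathcal V=\bigcup_{n=1}^\infty \mathbb R^n$ (disjoint union; vectors are column vectors of arbitrary finite dimension). $\mathbf 1_k\in\mathbb R^k$ is the all-ones vector, $\otimes$ the Kronecker product. For $x\in\mathbb R^m$, $y\in\mathbb R^n$ and $t=\mathrm{lcm}(m,n)$: V-addition $x\,\vec{+}\,y:=(x\otimes \mathbf 1_{t/m})+(y\otimes \mathbf 1_{t/n})\in\mathbb R^t$; V-subtraction $x\,\vec{\vdash}\,y:=x\,\vec{+}\,(-y)$; inner product $\langle x,y\rangle_{\mathcal V}:=\frac1t\langle x\otimes \mathbf 1_{t/m},\,y\otimes \mathbf 1_{t/n}\rangle$ (standard inner product of $\mathbb R^t$ on the right); norm $\|x\|_{\mathcal V}:=\sqrt{\langle x,x\rangle_{\mathcal V}}$; distance $d_{\mathcal V}(x,y):=\|x\,\vec{\vdash}\,y\|_{\mathcal V}$. These are in fact only a pseudo-norm and a pseudo-distance ($d_{\mathcal V}(x,y)=0$ does not imply $x=y$). $\mathcal T_d$ is the topology on $\mathcal V$ generated by the open balls of $d_{\mathcal V}$. *)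

(* Defs.v *)
From HB Require Import structures.
From mathcomp Require Import all_boot all_order all_algebra.
From mathcomp Require Import boolp classical_sets reals topology normedtype.
From mathcomp Require Import mxtens.
Set Implicit Arguments.
Unset Strict Implicit.
Unset Printing Implicit Defensive.
Import Order.TTheory GRing.Theory Num.Theory.
Import numFieldNormedType.Exports.
Local Open Scope classical_set_scope.
Local Open Scope ring_scope.

(* The disjoint union of the spaces R^n, n >= 1. *)
Record mixvec (R : realType) := MixVec {
  mvdim : nat;
  mvdim_gt0 : (0 < mvdim)%N;
  mvcol : 'cV[R]_mvdim }.

Lemma dim_mul_divn m t : (m %| t)%N -> (m * (t %/ m) = t)%N.
Proof. by move=> mt; rewrite mulnC divnK. Qed.

(* For m %| t, the vector x (x) 1_{t/m}, retyped from R^(m * (t/m)) to R^t. *)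
Definition stretch (R : realType) m t (mt : (m %| t)%N) (x : 'cV[R]_m) :
    'cV[R]_t :=
  castmx (dim_mul_divn mt, muln1 1) (x *t (const_mx 1 : 'cV[R]_(t %/ m))).

Lemma mvlcm_gt0 (R : realType) (x y : mixvec R) :
  (0 < lcmn (mvdim x) (mvdim y))%N.
Proof. by rewrite lcmn_gt0 !mvdim_gt0. Qed.

Definition mvadd (R : realType) (x y : mixvec R) : mixvec R :=
  MixVec (mvlcm_gt0 x y)
    (stretch (dvdn_lcml (mvdim x) (mvdim y)) (mvcol x) +
     stretch (dvdn_lcmr (mvdim x) (mvdim y)) (mvcol y)).

Definition mvopp (R : realType) (x : mixvec R) : mixvec R :=
  MixVec (mvdim_gt0 x) (- mvcol x).

Definition mvsub (R : realType) (x y : mixvec R) : mixvec R :=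
  mvadd x (mvopp y).

Definition dotcol (R : realType) n (u v : 'cV[R]_n) : R :=
  \sum_(i < n) u i 0 * v i 0.

Definition mvdot (R : realType) (x y : mixvec R) : R :=
  (lcmn (mvdim x) (mvdim y))%:R^-1 *
  dotcol (stretch (dvdn_lcml (mvdim x) (mvdim y)) (mvcol x))
         (stretch (dvdn_lcmr (mvdim x) (mvdim y)) (mvcol y)).

Definition mvnorm (R : realType) (x : mixvec R) : R := Num.sqrt (mvdot x x).

Definition mvdist (R : realType) (x y : mixvec R) : R := mvnorm (mvsub x y).

Definition mvball (R : realType) (p : mixvec R * R) : set (mixvec R) :=
  [set y | mvdist p.1 y < p.2].

HB.instance Definition _ (R : realType) := gen_eqMixin (mixvec R).
HB.instance Definition _ (R : realType) := gen_choiceMixin (mixvec R).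
HB.instance Definition _ (R : realType) :=
  isPointed.Build (mixvec R) (MixVec (ltn0Sn 0) 0).

(* The coarsest topology in which every open ball of positive radius is
   open. *)
HB.instance Definition _ (R : realType) :=
  isSubBaseTopological.Build (mixvec R)
    [set p : mixvec R * R | 0 < p.2] (@mvball R).

Definition path_connected (R : realType) (T : topologicalType) : Prop :=
  forall x y : T, exists f : R -> T,
    [/\ {within `[0, 1], continuous f}, f 0 = x & f 1 = y].

(* Main.v *)
Require Import Defs.
From mathcomp Require Import all_boot all_order all_algebra.
From mathcomp Require Import reals topology.
From mathcomp Require Import boolp classical_sets filter normedtype realfun.
Set Implicit Arguments.
Unset Strict Implicit.
Unset Printing Implicit Defensive.
Import Order.TTheory GRing.Theory Num.Theory.
Import numFieldNormedType.Exports.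
Local Open Scope classical_set_scope.
Local Open Scope ring_scope.

(** The distance from a fixed point [p] does not see the replacement of [x] by
    [x (x) 1_k].  Hence the segment from [x (x) 1_{N/m}] to [y (x) 1_{N/n}] in
    [R^N], [N = lcm(m, n)], with its endpoints replaced by [x] and [y], still has
    continuous distance to every [p], so preimages of balls are open. *)

(* Junk value [0] out of range. *)
Definition nat_coord (R : realType) m (x : 'cV[R]_m) (i : nat) : R :=
  oapp (fun k => x k 0) 0 (insub i).

Lemma nat_coord_ord (R : realType) m (x : 'cV[R]_m) (i : 'I_m) :
  nat_coord x i = x i 0.
Proof. by rewrite /nat_coord valK. Qed.

(** Row [i] of a Kronecker product splits by Euclidean division by the height [t %/ m] of the
    all-ones factor, so each entry of [x] is repeated in a block of that length. *)
Lemma stretchE (R : realType) m t (mt : (m %| t)%N) (x : 'cV[R]_m) i :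
  stretch mt x i 0 = nat_coord x (i %/ (t %/ m)).
Proof.
by rewrite /stretch castmxE !mxE mulr1 ord1 -nat_coord_ord.
Qed.

Lemma nat_coord_stretch (R : realType) m t (mt : (m %| t)%N) (x : 'cV[R]_m) i :
  (i < t)%N -> nat_coord (stretch mt x) i = nat_coord x (i %/ (t %/ m)).
Proof. by move=> it; rewrite -[i]/(val (Ordinal it)) nat_coord_ord stretchE. Qed.

Lemma ltn_div_divn (m t i : nat) : (m %| t)%N -> (i < t)%N ->
  (i %/ (t %/ m) < m)%N.
Proof.
move=> mt it; have t0 : (0 < t)%N by exact: leq_ltn_trans it.
have m0 : (0 < m)%N by exact: dvdn_gt0 mt.
by rewrite ltn_divLR ?divn_gt0 ?(dvdn_leq t0 mt) // mulnC divnK.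
Qed.

Lemma mvdot_self (R : realType) (z : mixvec R) :
  mvdot z z =
  (mvdim z)%:R^-1 * \sum_(0 <= i < mvdim z) nat_coord (mvcol z) i ^+ 2.
Proof.
have n0 := mvdim_gt0 z; rewrite /mvdot /dotcol.
under eq_bigr do rewrite !stretchE -expr2.
rewrite -(big_mkord xpredT (fun i =>
  nat_coord (mvcol z) (i %/ (lcmn (mvdim z) (mvdim z) %/ mvdim z)) ^+ 2)).
rewrite (lcmn_idPl (dvdnn _)) divnn n0; congr (_ * _).
by apply: eq_bigr => i _; rewrite divn1.
Qed.

Lemma sum_nat_divn (V : zmodType) (n k : nat) (F : nat -> V) : (0 < k)%N ->
  \sum_(0 <= i < n * k) F (i %/ k)%N = (\sum_(0 <= i < n) F i) *+ k.
Proof.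
move=> k0; rewrite big_nat_mul -sumrMnl; apply: eq_bigr => i _.
rewrite (eq_big_nat _ _ (F2 := fun=> F i)) => [|j /andP[ij ji]].
  by rewrite big_const_nat -mulnBl subSnn mul1n iter_addr_0.
by congr F; apply/eqP; rewrite eqn_leq leq_divRL // ij andbT -ltnS ltn_divLR.
Qed.

(** Passing from [L], the lcm of the dimensions, to [N = L * k] repeats each squared difference [k]
    times, and the factor [1/N] absorbs this. Freedom in [N] lets distances between vectors of
    different dimensions be computed on one grid. *)
Lemma mvdistE (R : realType) (p y : mixvec R) (N : nat) : (0 < N)%N ->
  (mvdim p %| N)%N -> (mvdim y %| N)%N ->
  mvdist p y = Num.sqrt (N%:R^-1 * \sum_(0 <= i < N)
    (nat_coord (mvcol p) (i %/ (N %/ mvdim p)) -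
     nat_coord (mvcol y) (i %/ (N %/ mvdim y))) ^+ 2).
Proof.
move=> N0 pN yN; rewrite /mvdist /mvnorm mvdot_self /=; congr Num.sqrt.
have pL := dvdn_lcml (mvdim p) (mvdim y).
have yL := dvdn_lcmr (mvdim p) (mvdim y).
have LN : (lcmn (mvdim p) (mvdim y) %| N)%N by rewrite dvdn_lcm pN.
set L := lcmn _ _ in pL yL LN *.
pose F i := (nat_coord (mvcol p) (i %/ (L %/ mvdim p)) -
             nat_coord (mvcol y) (i %/ (L %/ mvdim y))) ^+ 2.
transitivity (L%:R^-1 * \sum_(0 <= i < L) F i).
  congr (_ * _); apply: eq_big_nat => i /= iL.
  rewrite -[i]/(val (Ordinal iL)) nat_coord_ord mxE !stretchE /F /=.
  congr ((_ + _) ^+ 2).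
  (* [nat_coord] commutes with negation even out of range, the default value being 0. *)
  rewrite /nat_coord; case: insubP => [j _ _|_] /=; first by rewrite mxE.
  by rewrite oppr0.
clearbody L; have [k Nk] := dvdnP LN; rewrite mulnC in Nk.
have k0 : (0 < k)%N by move: N0; rewrite Nk muln_gt0 => /andP[].
have -> : \sum_(0 <= i < N) (nat_coord (mvcol p) (i %/ (N %/ mvdim p)) -
     nat_coord (mvcol y) (i %/ (N %/ mvdim y))) ^+ 2 =
     \sum_(0 <= i < L * k) F (i %/ k)%N.
  rewrite Nk; apply: eq_bigr => i _.
  (* For [d] dividing [L], [(L * k) %/ d = k * (L %/ d)], so dividing by it is dividing by [k], then
     by [L %/ d]. *)
  by rewrite /F -!divnMA !muln_divA ?(mulnC k).
rewrite sum_nat_divn // -[X in _ = _ * X]mulr_natl Nk natrM invfM -mulrA.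
by rewrite mulKf // pnatr_eq0 -lt0n.
Qed.

(** On the common grid of size [M], the nested quotients by [M %/ t] and [t %/ mvdim x] collapse to
    one quotient by [M %/ mvdim x]. *)
Lemma mvdist_stretch (R : realType) (p x : mixvec R) (t : nat) (t0 : (0 < t)%N)
    (xt : (mvdim x %| t)%N) :
  mvdist p (MixVec t0 (stretch xt (mvcol x))) = mvdist p x.
Proof.
set M := lcmn (mvdim p) t.
have M0 : (0 < M)%N by rewrite lcmn_gt0 mvdim_gt0.
have pM : (mvdim p %| M)%N by apply: dvdn_lcml.
have tM : (t %| M)%N by apply: dvdn_lcmr.
rewrite !(@mvdistE _ _ _ M) //=; last exact: dvdn_trans tM.
congr (Num.sqrt (_ * _)); apply: eq_big_nat => i /= iM.
rewrite nat_coord_stretch ?ltn_div_divn //.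
by rewrite -divnMA muln_divA // divnK.
Qed.

(** Balls form a subbase: an open set is a union of finite intersections of balls, and the preimage
    of each ball is a strict sublevel set of a continuous real function. *)
Lemma continuous_mvball (R : realType) (T : topologicalType)
    (f : T -> mixvec R) :
  (forall p, continuous (fun t => mvdist p (f t))) -> continuous f.
Proof.
move=> cf; apply/continuousP => A [D' sD' <-].
rewrite preimage_bigcup; apply: bigcup_open => B /sD'[E sE <-].
rewrite preimage_bigcap openE => t Et; rewrite /interior.
apply: filter_bigI => i Ei; apply: open_nbhs_nbhs; split; last exact: Et.
apply: (open_comp (f := fun s => mvdist i.1 (f s)) (D := [set r | r < i.2])).
  by move=> s _; exact: cf.
exact: open_lt.
Qed.

Definition mvlerp (R : realType) (x y : mixvec R) (t : R) : mixvec R :=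
  MixVec (mvlcm_gt0 x y)
    ((1 - t) *: stretch (dvdn_lcml (mvdim x) (mvdim y)) (mvcol x) +
     t *: stretch (dvdn_lcmr (mvdim x) (mvdim y)) (mvcol y)).

Lemma mvdist_lerp0 (R : realType) (p x y : mixvec R) :
  mvdist p (mvlerp x y 0) = mvdist p x.
Proof. by rewrite /mvlerp subr0 scale1r scale0r addr0 mvdist_stretch. Qed.

Lemma mvdist_lerp1 (R : realType) (p x y : mixvec R) :
  mvdist p (mvlerp x y 1) = mvdist p y.
Proof. by rewrite /mvlerp subrr scale1r scale0r add0r mvdist_stretch. Qed.

(** The dimension of [mvlerp x y t] does not depend on [t], so one grid size [M] serves all [t], and
    the distance is the square root of a finite sum of squares of affine functions of [t]. *)
Lemma continuous_mvdist_lerp (R : realType) (p x y : mixvec R) :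
  continuous (fun t => mvdist p (mvlerp x y t)).
Proof.
set T := lcmn (mvdim x) (mvdim y).
set M := lcmn (mvdim p) T.
have M0 : (0 < M)%N by rewrite lcmn_gt0 mvdim_gt0 mvlcm_gt0.
pose g t := M%:R^-1 * \sum_(0 <= i < M)
  (nat_coord (mvcol p) (i %/ (M %/ mvdim p)) -
   nat_coord (mvcol (mvlerp x y t)) (i %/ (M %/ T))) ^+ 2.
have -> : (fun t => mvdist p (mvlerp x y t)) = Num.sqrt \o g.
  by apply: funext => t; rewrite (@mvdistE _ _ _ M) ?dvdn_lcml ?dvdn_lcmr.
move=> t; suff cg : {for t, continuous g}.
  exact: (continuous_comp cg (@sqrt_continuous R (g t))).
apply: cvgM; first exact: cvg_cst.
(* Ordinal indices retain [i < M], which keeps [i %/ (M %/ T)] in range. *)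
rewrite big_mkord; under eq_cvg do rewrite big_mkord.
apply: cvg_big => [|i _]; first exact: add_continuous.
have iT : (i %/ (M %/ T) < T)%N by rewrite ltn_div_divn ?dvdn_lcmr.
pose h s := nat_coord (mvcol p) (i %/ (M %/ mvdim p)) -
  nat_coord (mvcol (mvlerp x y s)) (i %/ (M %/ T)).
suff ch : h s @[s --> t] --> h t by exact: (cvgM ch ch).
have coordE s : nat_coord (mvcol (mvlerp x y s)) (i %/ (M %/ T)) =
    (1 - s) * stretch (dvdn_lcml (mvdim x) (mvdim y)) (mvcol x) (Ordinal iT) 0 +
    s * stretch (dvdn_lcmr (mvdim x) (mvdim y)) (mvcol y) (Ordinal iT) 0.
  by rewrite -[(i %/ _)%N]/(val (Ordinal iT)) nat_coord_ord !mxE.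
rewrite /h coordE; under eq_cvg do rewrite coordE.
apply: cvgB; first exact: cvg_cst.
apply: cvgD; apply: cvgM; try exact: cvg_cst; last exact: cvg_id.
by apply: cvgB; [exact: cvg_cst|exact: cvg_id].
Qed.

Theorem mainTheorem1 (R : realType) : path_connected R (mixvec R).
Proof.
move=> x y.
(* [mvlerp x y 0] lies in dimension [lcmn (mvdim x) (mvdim y)], so it need not equal [x]; likewise
   for [y] at 1. *)
exists (fun t : R => if t == 0 then x else if t == 1 then y else mvlerp x y t).
split; last 2 first.
- by rewrite eqxx.
- by rewrite oner_eq0 eqxx.
apply/continuous_subspaceT/continuous_mvball => p.
(* Overriding the endpoints leaves every distance function unchanged on the whole line. *)
rewrite (_ : (fun _ => _) = fun t => mvdist p (mvlerp x y t)).
  exact: continuous_mvdist_lerp.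
apply: funext => t; case: eqVneq => [->|_]; first by rewrite mvdist_lerp0.
by case: eqVneq => [->|//]; rewrite mvdist_lerp1.
Qed.
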